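(* Let $p\in[1,\infty[$, let $(\Omega,\mathcal F,\mathbb P)$ be an atomless probability space, and let $\rho:L^p(\Omega,\mathcal F,\mathbb P)\to\mathbb R$ be convex, nondecreasing with respect to the $\mathbb P$-almost sure partial order, and law-invariant. Let $f:\mathbb R^n\times\mathbb R^s\to\mathbb R$ be Borel-measurable and limited by an exponent $\gamma\in]0,\infty[$, and let $D_f$ be its set of discontinuity points. If $x\in\mathbb R^n$ and $\nu\in\mathcal M_1^{\|\cdot\|^{\gamma p}}(\mathbb R^s)$ satisfy $(\delta_x\otimes\nu)(D_f)=0$, then the mapping $$Q:\mathbb R^n\times\mathcal M_1^{\|\cdot\|^{\gamma p}}(\mathbb R^s)\to\mathbb R,\qquad Q(x,\nu)=\mathcal R_\rho\big((\delta_x\otimes\nu)\circ f^{-1}\big),$$ is continuous at $(x,\nu)$ with respect to the product topology of the standard topology on $\mathbb R^n$ and the $\|\cdot\|^{\gamma p}$-weak topology on $\mathcal M_1^{\|\cdot\|^{\gamma p}}(\mathbb R^s)$.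
   Context: Atomless means that $(\Omega,\mathcal F,\mathbb P)$ supports a random variable $U$ uniformly distributed on $]0,1[$. $\rho$ is law-invariant if $\rho(Y)=\rho(\widetilde Y)$ whenever $Y,\widetilde Y\in L^p(\Omega,\mathcal F,\mathbb P)$ have the same law under $\mathbb P$. $\|\cdot\|$ is the Euclidean norm. A mapping $e:\mathbb R^n\times\mathbb R^s\to\mathbb R$ is limited by the exponent $\gamma\in]0,\infty[$ if there is a locally bounded mapping $\eta:\mathbb R^n\to]0,\infty[$ with $|e(x,z)|\le\eta(x)(\|z\|^\gamma+1)$ for all $(x,z)\in\mathbb R^n\times\mathbb R^s$. For $q>0$, $\mathcal M_1^{\|\cdot\|^q}(\mathbb R^d)$ is the set of Borel probability measures $\mu$ on $\mathbb R^d$ with $\int\|z\|^q\,\mu(dz)<\infty$ (for $d=1$ written $\mathcal M_1^{|\cdot|^q}(\mathbb R)$). The $\|\cdot\|^q$-weak topology on it is the coarsest topology for which all mappings $\mu\mapsto\int g\,d\mu$ are continuous, where $g$ ranges over the continuous functions $g:\mathbb R^d\to\mathbb R$ with $\sup_{y\in\mathbb R^d}|g(y)|/(1+\|y\|^q)<\infty$. $\mathcal R_\rho:\mathcal M_1^{|\cdot|^p}(\mathbb R)\to\mathbb R$ is defined by $\mathcal R_\rho(\mu)=\rho(F_\mu^{\leftarrow}(U))$, where $F_\mu^{\leftarrow}$ is the left-continuous quantile function of the distribution function of $\mu$. $\delta_x$ is the Dirac measure at $x$, and $(\delta_x\otimes\nu)\circ f^{-1}$ is the image measure under $f$ (which has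 finite absolute moment of order $p$ under the growth assumption on $f$). *)

(* Defs.v *)
From HB Require Import structures.
From mathcomp Require Import all_boot all_order all_algebra.
From mathcomp Require Import all_classical all_reals all_analysis measurable_realfun.
From mathcomp Require Import lra.

Set Implicit Arguments.
Unset Strict Implicit.
Unset Printing Implicit Defensive.
Import Order.TTheory GRing.Theory Num.Theory.
Import numFieldNormedType.Exports.

Local Open Scope classical_set_scope.
Local Open Scope ring_scope.

(* Borel sigma-algebra of the standard topology of matrices; in particular on
   'rV[R]_n.  A product 'rV[R]_n * 'rV[R]_s then carries the product of the Borel
   sigma-algebras, which is the Borel sigma-algebra of the product. *)
HB.instance Definition _ (R : realType) (m n : nat) :=
  @isMeasurable.Build (sigma_display (@open 'M[R]_(m, n))) 'M[R]_(m, n)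
    <<s @open 'M[R]_(m, n) >> (@sigma_algebra0 _ setT _)
    (@sigma_algebraC _ _) (@sigma_algebra_bigcup _ setT _).

(* The library norm `|x| on 'rV[R]_n is the sup norm. *)
Definition enorm (R : realType) (n : nat) (x : 'rV[R]_n) : R :=
  Num.sqrt (\sum_(i < n) x 0 i ^+ 2).

Definition limited_by (R : realType) (n s : nat)
    (e : 'rV[R]_n * 'rV[R]_s -> R) (gamma : R) : Prop :=
  exists eta : 'rV[R]_n -> R,
    [/\ forall x, 0 < eta x,
        forall x : 'rV[R]_n, bounded_near eta (nbhs x) &
        forall x z, `|e (x, z)| <= eta x * (enorm z `^ gamma + 1)].

(* As for any measure of the library, values on non-measurable sets are
   unconstrained, so one probability law may have several representatives; all
   of them are topologically indistinguishable for the topology below. *)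
Record prob_moment d (T : measurableType d) (R : realType) (N : T -> R)
    (q : R) := ProbMoment {
  pm_prob :> probability T R ;
  pm_moment : (\int[pm_prob]_z ((N z) `^ q)%:E < +oo)%E }.

Definition M1 (R : realType) (n : nat) (q : R) :=
  prob_moment (@enorm R n) q.
Definition M1R (R : realType) (q : R) :=
  prob_moment (@Num.norm R R) q.

Section weak_topology.
Context (R : realType) (n : nat) (q : R).

Definition test_fun := {g : 'rV[R]_n -> R | continuous g /\
   has_ubound (range (fun y => `|g y| / (1 + enorm y `^ q)))}.

HB.instance Definition _ := gen_eqMixin (M1 n q).
HB.instance Definition _ := gen_choiceMixin (M1 n q).
(* The coarsest topology making mu |-> \int g dmu continuous for all g. *)
HB.instance Definition _ := Topological.copy (M1 n q)
  (@sup_topology (M1 n q) test_fun (fun g => Topological.class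
     (initial_topology (fun mu : M1 n q => \int[mu]_z (projT1 g z) : R)%R))).
End weak_topology.

(* Only the values at u in ]0, 1[ are meaningful: outside, the set may be empty
   or unbounded below, and inf then returns 0. *)
Definition quantile (R : realType) (mu : probability R R) (u : R) : R :=
  inf [set x : R | (u%:E <= mu `]-oo, x]%classic)%E].

(* The library's uniform_prob lives on [0, 1], hence has the same law as the
   uniform probability on ]0, 1[.  A space is atomless when it carries such a
   U. *)
Definition unif01 d (Omega : measurableType d) (R : realType)
    (P : probability Omega R) (U : {RV P >-> R}) : Prop :=
  forall A : set R, measurable A ->
    distribution P U A = uniform_prob (@ltr01 R) A.

(* L^p is represented by LfunType P p1, the p-integrable functions, which are not
   quotiented by almost sure equality.  A functional satisfying either of the two
   conditions below takes the same value on almost surely equal functions, so it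
   is the same thing as a functional on the quotient. *)
Section Lp_functionals.
Context d (Omega : measurableType d) (R : realType) (p : R).
Context (p1 : (1 <= p%:E)%E) (P : probability Omega R).
Variable rho : LfunType P p1 -> R.

Definition as_nondecreasing : Prop := forall X Y : LfunType P p1,
  {ae P, forall w, X w <= Y w} -> rho X <= rho Y.

Definition law_invariant : Prop := forall X Y : LfunType P p1,
  (forall A : set R, measurable A ->
    distribution P X A = distribution P Y A) ->
  rho X = rho Y.

End Lp_functionals.

Definition discontinuity_set (T U : topologicalType) (f : T -> U) : set T :=
  [set w | ~ {for w, continuous f}].

Section quantile_facts.
Context (R : realType) (mu : probability R R).
Let F (x : R) := mu `]-oo, x]%classic.

Let idR : R -> R := idfun.
#[local] HB.instance Definition _ :=
  @isMeasurableFun.Build _ _ R R idR (@measurable_id _ _ setT).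

Let cdfE : F = cdf (idR : {RV mu >-> R}).
Proof. by apply/funext => x; rewrite /F /cdf /distribution /pushforward preimage_id. Qed.

Lemma quantile_le (u x : R) : 0 < u < 1 ->
  (quantile mu u <= x) = (u%:E <= mu `]-oo, x]%classic)%E.
Proof.
move=> /andP[u0 u1].
have Fnd (a b : R) : a <= b -> (F a <= F b)%E.
  by move=> ab; rewrite cdfE; exact: cdf_nondecreasing.
pose A := [set y : R | (u%:E <= F y)%E].
have A0 : A !=set0.
  have := cvg_cdfy1 (idR : {RV mu >-> R}); rewrite -cdfE => Fy.
  have : \forall y \near +oo%R, (u%:E < F y)%E.
    by apply: (Fy [set z | (u%:E < z)%E]); apply: open_ereal_gt'; rewrite lte_fin.
  move=> /pinfty_ex_gt0[y _ uy]; exists y; exact: ltW.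
have lbA : has_lbound A.
  have := cvg_cdfNy0 (idR : {RV mu >-> R}); rewrite -cdfE => Fy.
  have : \forall y \near -oo%R, (F y < u%:E)%E.
    by apply: (Fy [set z | (z < u%:E)%E]); apply: open_ereal_lt'; rewrite lte_fin.
  move=> [m [_ Hm]]; exists (m - 1) => a Aa; rewrite leNgt; apply/negP => am.
  have : (F a < u%:E)%E by apply: Hm; rewrite (lt_trans am)// ltrBlDr ltrDl.
  by rewrite ltNge Aa.
have Ainf : (u%:E <= F (inf A))%E.
  have rc : F y @[y --> (inf A)^'+] --> F (inf A).
    by rewrite cdfE; exact: cdf_right_continuous.
  apply: (cvge_to_ge rc); near=> y.
  have [a Aa ay] : exists2 a, A a & a < y.
    by apply: inf_lt => //; near: y; exact: nbhs_right_gt.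
  by apply: (le_trans Aa); apply: Fnd; exact: ltW.
apply/idP/idP => [qx|ux].
  by apply: (le_trans Ainf); apply: Fnd.
by apply: ge_inf.
Unshelve. all: by end_near. Qed.

End quantile_facts.

Lemma measure_unique_cdf (R : realType) (m1 m2 : probability R R) :
  (forall x : R, m1 `]-oo, x]%classic = m2 `]-oo, x]%classic) ->
  forall A : set R, measurable A -> m1 A = m2 A.
Proof.
move=> m12; apply: (@measure_unique _ _ _ (@ocitv R)
  (fun k => `](- k%:R), k%:R]%classic)) => //.
- by move=> A B; exact: ocitvI.
- by move=> i; exact: is_ocitv.
- apply/seteqP; split => // x _.
  have [k xk] : exists k : nat, `|x| < k%:R.
    by exists (Num.truncn `|x|).+1; rewrite truncnS_gt.
  exists k => //=; rewrite in_itv/=.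
  by move: xk; rewrite ltr_norml => /andP[-> /ltW].
- move=> _ [[a b] _ <-] /=.
  have [ab|ba] := leP a b; last first.
    by rewrite set_itv_ge ?measure0// bnd_simp -leNgt ltW.
  have -> : `]a, b]%classic = `]-oo, b] `\` `]-oo, a] :> set R.
    by rewrite -[RHS]setCK setCD setCitvl setUC -[LHS]setCK setCitv.
  have sub : `]-oo, a]%classic `<=` (`]-oo, b]%classic : set R).
    exact: subset_itvl.
  rewrite !measureD ?(setIidr sub)//; last 2 first.
  - by rewrite ltey_eq fin_num_measure.
  - by rewrite ltey_eq fin_num_measure.
  by congr (_ - _)%E; exact: m12.
- by move=> k; rewrite ltey_eq fin_num_measure.
Qed.

Section quantile_transform.
Context d (Omega : measurableType d) (R : realType).
Context (P : probability Omega R) (U : {RV P >-> R}).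

Lemma measurable_quantile (mu : probability R R) :
  measurable_fun setT (quantile mu).
Proof.
have -> : [set: R] = `]-oo, 0] `|` `]0, 1[ `|` [set 1] `|` `]1, +oo[.
  apply/seteqP; split => // x _ /=; rewrite !in_itv/= !andbT.
  case: (ltgtP x 1) => [x1|x1|->]; last by left; right.
  - by left; left; case: (leP x 0) => x0; [left|right].
  - by right.
apply/measurable_funU => //; [by do ?apply: measurableU|split].
  apply/measurable_funU => //; [by do ?apply: measurableU|split].
    apply/measurable_funU => //; split.
      apply: (eq_measurable_fun (cst 0 : R -> R)); last exact: measurable_cst.
      move=> u; rewrite inE/= in_itv/= => u0; rewrite /quantile.
      rewrite (_ : [set _ | _] = setT) ?inf_out//.
        move=> -[_ [y /(_ (y - 1) I)]]; lra.
      by apply/seteqP; split => // x _ /=; rewrite (@le_trans _ _ 0%E)// lee_fin.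
    apply: (measurability (@RGenOInfty.G R)).
      exact: RGenOInfty.measurableE.
    move=> _ [_ [x ->] <-].
    rewrite [X in measurable X](_ : _ =
      `]0, 1[%classic `&` `](fine (mu `]-oo, x]%classic)), +oo[%classic).
      exact: measurableI.
    apply/seteqP; split => u /= [u01]; rewrite !in_itv/= !andbT => H;
      split => //; move: u01 H; rewrite in_itv/= => u01.
      by rewrite !ltNge quantile_le// -lee_fin fineK// fin_num_measure.
    by rewrite !ltNge quantile_le// -lee_fin fineK// fin_num_measure.
  exact: measurable_fun_set1.
apply: (eq_measurable_fun (cst 0 : R -> R)); last exact: measurable_cst.
move=> u; rewrite inE/= in_itv/= andbT => u1; rewrite /quantile.
rewrite (_ : [set _ | _] = set0) ?inf0//.
apply/seteqP; split => // x /=; apply/negP; rewrite -ltNge.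
by rewrite (@le_lt_trans _ _ 1%E) ?lte_fin// probability_le1.
Qed.

Definition quantile_tr (mu : probability R R) (w : Omega) : R :=
  quantile mu (U w).

Lemma measurable_quantile_tr (mu : probability R R) :
  measurable_fun setT (quantile_tr mu).
Proof.
by apply: (measurableT_comp (measurable_quantile mu)); exact: measurable_funPT.
Qed.

HB.instance Definition _ (mu : probability R R) :=
  @isMeasurableFun.Build _ _ Omega R (quantile_tr mu)
    (measurable_quantile_tr mu).

Hypothesis U01 : unif01 U.

Lemma distribution_quantile_tr (mu : probability R R) (A : set R) :
  measurable A -> distribution P (quantile_tr mu) A = mu A.
Proof.
move: A; apply: (@measure_unique_cdf _ (distribution P (quantile_tr mu)) mu).
move=> x.
set m := mu _.
have m0 : 0 <= fine m by rewrite fine_ge0 ?measure_ge0.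
have m1 : fine m <= 1.
  by rewrite -lee_fin fineK ?fin_num_measure// probability_le1.
have UB (A : set R) : measurable A ->
    P (U @^-1` A) = lebesgue_measure (A `&` `[0, 1]).
  move=> mA; have := U01 mA; rewrite /distribution /pushforward => ->.
  rewrite /uniform_prob integral_uniform_pdf.
  rewrite (eq_integral (cst 1%E)).
    by rewrite integral_cst ?mul1e//; exact: measurableI.
  move=> u; rewrite inE => -[_ /=]; rewrite in_itv/= /uniform_pdf => ->.
  by rewrite subr0 invr1.
pose B := quantile mu @^-1` `]-oo, x]%classic.
have mB : measurable B.
  by rewrite -[B]setTI; apply: measurable_quantile.
transitivity (P (U @^-1` B)); first by [].
rewrite UB//.
transitivity (lebesgue_measure (`]0%R, fine m]%classic : set R)); last first.
  rewrite lebesgue_measure_itv/= lte_fin.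
  have mfin : ((fine m)%:E = m) by rewrite fineK// fin_num_measure.
  case: ltP => [_|m0']; first by rewrite -EFinB subr0.
  by rewrite -mfin; congr EFin; apply/eqP; rewrite eq_le m0.
pose N : set R := [set 0] `|` [set 1].
have N0 : lebesgue_measure N = 0%E.
  by rewrite measureU0//= lebesgue_measure_set1.
rewrite -[LHS](measureU0 _ _ N0); [|exact: measurableI|exact: measurableU].
rewrite -[RHS](measureU0 _ _ N0)//; last exact: measurableU.
congr (lebesgue_measure _); apply/seteqP.
have E u : 0 < u < 1 -> (quantile mu u <= x) = (u <= fine m).
  by move=> u01; rewrite quantile_le// -lee_fin fineK// fin_num_measure.
split => u [|Nu]; try by right.
- move=> [/=]; rewrite /B/= !in_itv/= => qu /andP[].
  rewrite le_eqVlt => /predU1P[<- _|u0]; first by right; left.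
  rewrite le_eqVlt => /predU1P[->|u1]; first by right; right.
  by left; rewrite /= u0 -E ?u0.
- rewrite /= in_itv/= => /andP[u0 um].
  have := le_trans um m1; rewrite le_eqVlt => /predU1P[->|u1].
    by right; right.
  have qx : quantile mu u <= x by rewrite E// u0.
  by left; split; rewrite /B /= in_itv/= ?qx// !ltW.
Qed.

Lemma quantile_tr_Lfun (p : R) (mu : M1R p) :
  quantile_tr mu \in Lfun P p%:E.
Proof.
apply/andP; split; rewrite inE/=; first exact: measurable_quantile_tr.
rewrite /finite_norm unlock; apply: poweR_lty.
have mp : measurable_fun setT (fun y : R => (`|y| `^ p)%:E).
  apply/measurable_EFinP; apply: (measurableT_comp (measurable_powR p)).
  exact: normr_measurable.
rewrite [ltLHS](_ : _ = \int[mu]_y (`|y| `^ p)%:E)%E; first exact: pm_moment.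
rewrite [RHS](eq_measure_integral (distribution P (quantile_tr mu))); last first.
  by move=> A mA _; exact/esym/distribution_quantile_tr.
by rewrite ge0_integral_distribution// => y; rewrite lee_fin powR_ge0.
Qed.

End quantile_transform.

Definition quantile_Lp d (Omega : measurableType d) (R : realType) (p : R)
    (p1 : (1 <= p%:E)%E) (P : probability Omega R) (U : {RV P >-> R})
    (U01 : unif01 U) (mu : M1R p) : LfunType P p1 :=
  Lfun_Sub p1 (quantile_tr_Lfun U01 mu).

Definition risk_functional d (Omega : measurableType d) (R : realType) (p : R)
    (p1 : (1 <= p%:E)%E) (P : probability Omega R) (rho : LfunType P p1 -> R)
    (U : {RV P >-> R}) (U01 : unif01 U) (mu : M1R p) : R :=
  rho (quantile_Lp p1 U01 mu).

Lemma measurable_continuous_mx (R : realType) (m n : nat)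
    (g : 'M[R]_(m, n) -> R) :
  continuous g -> measurable_fun setT g.
Proof.
move=> /continuousP cg; apply: (measurability (@RGenOInfty.G R)).
  exact: RGenOInfty.measurableE.
move=> _ [_ [x ->] <-]; rewrite setTI; apply: sub_sigma_algebra.
by apply: cg; exact: interval_open.
Qed.

Lemma cvg_sqr_coord (R : realType) (n : nat) (x : 'rV[R]_n) :
  \sum_(i < n) y 0 i ^+ 2 @[y --> x] --> \sum_(i < n) x 0 i ^+ 2.
Proof.
have hi (i : 'I_n) : y 0 i ^+ 2 @[y --> x] --> x 0 i ^+ 2.
  apply: (@continuous_comp _ _ _ (fun y : 'rV[R]_n => y 0 i)
    (fun u => u ^+ 2)); [exact: coord_continuous | exact: exprn_continuous].
elim: (index_enum _) => [|i r IH].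
  rewrite big_nil; under eq_fun do rewrite big_nil.
  exact: cvg_cst.
rewrite big_cons; under eq_fun do rewrite big_cons.
exact: cvgD.
Qed.

Lemma continuous_enorm (R : realType) (n : nat) : continuous (@enorm R n).
Proof.
move=> x; apply: (@continuous_comp _ _ _
  (fun y : 'rV[R]_n => \sum_(i < n) y 0 i ^+ 2) (@Num.sqrt R)); last first.
  exact: sqrt_continuous.
exact: cvg_sqr_coord.
Qed.

Section image.
Context (R : realType) (n s : nat) (p gamma : R).
Variable f : 'rV[R]_n * 'rV[R]_s -> R.
Hypothesis mf : measurable_fun setT f.

(* An alias of f carrying its measurability, so that distribution applies. *)
Definition mimage_fun (w : 'rV[R]_n * 'rV[R]_s) : R := f w.

HB.instance Definition _ :=
  @isMeasurableFun.Build _ _ ('rV[R]_n * 'rV[R]_s)%type R mimage_fun mf.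

Hypothesis p1 : (1 <= p%:E)%E.
Hypothesis fgamma : limited_by f gamma.
Context (x : 'rV[R]_n) (nu : M1 s (gamma * p)).

Definition image_prob : probability R R :=
  distribution (\d_x \x nu)%E mimage_fun.

Lemma image_prob_moment : (\int[image_prob]_y (`|y| `^ p)%:E < +oo)%E.
Proof.
have p0 : 0 < p by rewrite (lt_le_trans ltr01)// -lee_fin.
have mp : measurable_fun setT (fun y : R => (`|y| `^ p)%:E).
  apply/measurable_EFinP; apply: (measurableT_comp (measurable_powR p)).
  exact: normr_measurable.
rewrite ge0_integral_distribution//.
have mfp : measurable_fun setT
    ((fun y => (`|y| `^ p)%:E) \o mimage_fun).
  by apply: (measurableT_comp mp); exact: mf.
rewrite (fubini_tonelli1 _ mfp); last by move=> w; rewrite lee_fin powR_ge0.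
rewrite integral_dirac//; last first.
  apply: measurable_fun_fubini_tonelli_F => // w.
  by rewrite lee_fin powR_ge0.
rewrite diracT mul1e /fubini_F.
have [eta [eta0 _ fle]] := fgamma.
pose C := (eta x * 2) `^ p.
have me : measurable_fun setT (fun z : 'rV[R]_s => enorm z).
  exact: measurable_continuous_mx (@continuous_enorm R s).
have mh : measurable_fun setT
    (fun z : 'rV[R]_s => (enorm z `^ (gamma * p))%:E).
  apply/measurable_EFinP; exact: (measurableT_comp (measurable_powR _)).
apply: (@le_lt_trans _ _
  (\int[nu]_z (C%:E * ((enorm z `^ (gamma * p))%:E + 1)))%E).
  apply: ge0_le_integral => //.
  - by move=> z _; rewrite lee_fin powR_ge0.
  - by apply: (measurableT_comp mfp); exact: pair1_measurable.
  - by apply: emeasurable_funM => //; exact: emeasurable_funD.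
  - move=> z _ /=; rewrite -EFinD -EFinM lee_fin.
    rewrite (@le_trans _ _ ((eta x * (enorm z `^ gamma + 1)) `^ p))//.
      apply: ge0_ler_powR; [exact: ltW|by rewrite nnegrE| |exact: fle].
      by rewrite nnegrE mulr_ge0 ?addr_ge0 ?powR_ge0// ltW.
    set a := enorm z `^ gamma.
    have a0 : 0 <= a by exact: powR_ge0.
    rewrite powRrM -/a.
    apply: (@le_trans _ _ ((eta x * 2 * Num.max a 1) `^ p)).
      apply: ge0_ler_powR; [exact: ltW| | |].
      + by rewrite nnegrE !mulr_ge0 ?addr_ge0// ltW.
      + by rewrite nnegrE !mulr_ge0// ?le_max ?a0// ltW.
      + by rewrite -mulrA ler_pM2l//; case: (lerP a 1) => ?; lra.
    rewrite powRM; [|by rewrite mulr_ge0// ltW|by rewrite le_max a0].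
    rewrite ler_wpM2l ?powR_ge0//.
    by case: (lerP a 1) => _; rewrite ?powR1 ?lerDl ?lerDr ?powR_ge0.
rewrite ge0_integralZl//; last 3 first.
- exact: emeasurable_funD.
- by move=> z _; rewrite -EFinD lee_fin addr_ge0 ?powR_ge0.
- by rewrite lee_fin powR_ge0.
rewrite ge0_integralD//; last by move=> z _; rewrite lee_fin powR_ge0.
have -> : (\int[nu]__ 1 = 1)%E.
  by rewrite integral_cst// mul1e; exact: probability_setT.
rewrite lte_mul_pinfty ?lee_fin ?powR_ge0//.
by rewrite lte_add_pinfty ?ltry//; exact: pm_moment.
Qed.

Definition image_M1 : M1R p := ProbMoment image_prob_moment.

End image.

Definition risk_Q d (Omega : measurableType d) (R : realType) (p : R)
    (p1 : (1 <= p%:E)%E) (P : probability Omega R) (rho : LfunType P p1 -> R)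
    (U : {RV P >-> R}) (U01 : unif01 U) (n s : nat)
    (f : 'rV[R]_n * 'rV[R]_s -> R) (mf : measurable_fun setT f) (gamma : R)
    (fgamma : limited_by f gamma) (w : 'rV[R]_n * M1 s (gamma * p)) : R :=
  risk_functional rho U01 (image_M1 mf p1 fgamma w.1 w.2).

(* Main.v *)
(* Q(x, nu) is rho evaluated at the quantile function of the image measure,
   composed with U: it suffices that rho is continuous on L^p and that this
   random variable depends continuously in L^p on (x, nu).

   Continuity of rho: if Y_k -> X so fast that
   Z = (sum_k (2^k |Y_k - X|)^p)^(1/p) lies in L^p, then
   |Y_k - X| <= 2^-k Z, and monotonicity and convexity give
   |rho Y_k - rho X| <= 2^-k (rho (X + Z) - rho X).

   Continuity of the quantiles: convergence of the integrals of countably many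
   piecewise linear ramps gives almost sure convergence along a sequence, and
   convergence of the p-th moments upgrades it to convergence in L^p.

   Convergence of int g(f(x', z)) nu'(dz) as (x', nu') -> (x, nu), for g of
   growth p: after division by the weight 1 + |z|^(gamma p), the integrand is
   bounded near x, and it is dominated, uniformly in x' near x, by Lipschitz
   envelopes in z which decrease to it wherever f is continuous at (x, z).
   Multiplied back by the weight, the envelopes are test functions of the weak
   topology, so int g(f) is upper semicontinuous; apply this to g and -g. *)

Require Import Defs.
From HB Require Import structures.
From mathcomp Require Import all_boot all_order all_algebra.
From mathcomp Require Import all_classical all_reals all_analysis.
From mathcomp Require Import measurable_realfun ring lra.

Set Implicit Arguments.
Unset Strict Implicit.
Unset Printing Implicit Defensive.
Import Order.TTheory GRing.Theory Num.Theory.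
Import numFieldNormedType.Exports.

Local Open Scope classical_set_scope.
Local Open Scope ring_scope.

(** * Continuity of monotone convex functionals on [L^p] *)

Section monotone_convex_functionals.
Context d (Omega : measurableType d) (R : realType) (p : R).
Context (p1 : (1 <= p%:E)%E) (P : probability Omega R).
Variable rho : LfunType P p1 -> R.
Hypothesis rho_convex : convex_function setT rho.
Hypothesis rho_nondecreasing : as_nondecreasing rho.

Let convex_le (X Y : LfunType P p1) (t : R) : 0 <= t <= 1 ->
  rho (t *: X + (1 - t) *: Y) <= t * rho X + (1 - t) * rho Y.
Proof.
move=> /andP[t0 t1].
have t01 : Itv.spec (@Itv.num_sem R) (Itv.Real `[0%Z, 1%Z]) t.
  by apply/andP; split; [exact: ger0_real|rewrite in_itv/= t0].
have := @rho_convex (Itv.mk t01) X Y (mem_setT _) (mem_setT _).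
by rewrite convRE.
Qed.

(** Above: [Y] is at most [X + t Z], a convex combination of [X + Z] and [X]. Below: [Y] is at least
    [X - t Z], and [X] is a convex combination of [X + Z] and [X - t Z]. *)
Lemma convex_increment_le (X Y Z : LfunType P p1) (t : R) : 0 <= t <= 1 ->
  {ae P, forall w, `|Y w - X w| <= t * Z w} ->
  `|rho Y - rho X| <= t * (rho (X + Z) - rho X).
Proof.
move=> t01 dY; have /andP[t0 t1] := t01.
have h1 : rho Y <= t * rho (X + Z) + (1 - t) * rho X.
  apply: le_trans (convex_le _ _ t01); apply: rho_nondecreasing.
  apply: filterS dY => w; rewrite ler_norml => /andP[_].
  rewrite (_ : (t *: (X + Z) + (1 - t) *: X) w =
    t * (X w + Z w) + (1 - t) * X w)//; lra.
have h2 : (1 + t) * rho X <= t * rho (X + Z) + rho Y.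
  (* This weight solves [s = (1 - s) * t], so the [Z] terms of the combination of [X + Z] and
     [X - t Z] cancel. *)
  pose s := t / (1 + t).
  have s01 : 0 <= s <= 1.
    by rewrite divr_ge0 ?addr_ge0//= ler_pdivrMr ?ltr_pwDl//; lra.
  have sE : 1 - s = (1 + t)^-1 by rewrite /s; field; lra.
  have XE : X = s *: (X + Z) + (1 - s) *: (X - t *: Z).
    apply/LfuneqP => w.
    rewrite (_ : (s *: (X + Z) + _) w =
      s * (X w + Z w) + (1 - s) * (X w - t * Z w))// sE /s; field; lra.
  have : rho X <= s * rho (X + Z) + (1 - s) * rho Y.
    rewrite {1}XE; apply: le_trans (convex_le _ _ s01) _.
    rewrite lerD2l; apply: ler_wpM2l; first by rewrite sE invr_ge0; lra.
    apply: rho_nondecreasing; apply: filterS dY => w.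
    rewrite ler_norml => /andP[+ _].
    rewrite (_ : (X - t *: Z) w = X w - t * Z w)//; lra.
  have -> : s * rho (X + Z) + (1 - s) * rho Y =
      (t * rho (X + Z) + rho Y) / (1 + t) by rewrite /s; field; lra.
  by rewrite ler_pdivlMr ?[_ * (1 + t)]mulrC//; lra.
rewrite ler_norml; apply/andP; split; lra.
Qed.
End monotone_convex_functionals.

(** Take for [Z] the [p]-th root of the sum over [k] of [(2^k D_k)^p]. The sum has integral at most
    1, and each term is bounded by the whole sum. *)
Lemma Lp_dominating_sequence d (Omega : measurableType d) (R : realType)
    (P : {measure set Omega -> \bar R}) (p : R) (D : nat -> Omega -> R) :
  0 < p ->
  (forall k, measurable_fun setT (D k)) -> (forall k w, 0 <= D k w) ->
  (forall k, (\int[P]_w ((2 ^+ k * D k w) `^ p)%:E <= (2^-1 ^+ k.+1)%:E)%E) ->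
  exists Z : Omega -> R, Z \in Lfun P p%:E /\
    {ae P, forall w, forall k, D k w <= 2^-1 ^+ k * Z w}.
Proof.
move=> p0 mD D0 intD.
pose h k w := ((2 ^+ k * D k w) `^ p)%:E.
have mh k : measurable_fun setT (h k).
  apply/measurable_EFinP; apply: (measurableT_comp (measurable_powR p)).
  exact: measurable_funM.
have h0 k w : (0 <= h k w)%E by rewrite lee_fin powR_ge0.
pose S w := (\sum_(0 <= k <oo) h k w)%E.
have S0 w : (0 <= S w)%E by exact: nneseries_ge0.
have mS : measurable_fun setT S.
  exact: (@ge0_emeasurable_sum _ _ _ setT h xpredT).
have intS : (\int[P]_w S w < +oo)%E.
  rewrite integral_nneseries//.
  apply: (@le_lt_trans _ _ (\sum_(0 <= k <oo) (2^-1 ^+ k.+1)%:E)%E).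
    by apply: lee_nneseries => k *; [exact: integral_ge0|exact: intD].
  have -> : (\sum_(0 <= k <oo) (2^-1 ^+ k.+1)%:E)%E = (1 / 2 ^+ 0 : R)%:E.
    rewrite -(cvg_lim _ (@cvg_geometric_eseries_half R 1 0))//=.
    by apply: eq_eseriesr => k _; rewrite addn1 exprVn natrX div1r.
  exact: ltry.
(* Where the sum is infinite, [fine] returns 0 and the domination could fail; these points form a
   null set. *)
have aeS : {ae P, forall w, S w \is a fin_num}.
  have : P.-integrable setT S.
    apply/integrableP; split => //.
    by under eq_integral do rewrite gee0_abs//.
  by move=> /(integrable_ae measurableT); apply: filterS => w /(_ I).
exists (fun w => (fine (S w)) `^ p^-1); split.
  have mZ : measurable_fun setT (fun w => (fine (S w)) `^ p^-1).
    apply: (measurableT_comp (measurable_powR _)).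
    exact: measurableT_comp.
  apply/andP; split; rewrite inE/=; first exact: mZ.
  rewrite /finite_norm unlock; apply: poweR_lty.
  apply: le_lt_trans intS.
  apply: ge0_le_integral => //.
    by move=> w _; exact: poweR_ge0.
    apply: (measurableT_comp (measurable_poweR p)).
    by apply: measurableT_comp => //; exact/measurable_EFinP.
  move=> w _; rewrite abse_EFin ger0_norm ?powR_ge0// poweR_EFin -powRrM.
  rewrite mulVf ?gt_eqF// powRr1 ?fine_ge0//.
  by case: (S w) (S0 w) => //= r _; rewrite leey.
apply: filterS aeS => w Sfin k.
rewrite [leRHS]mulrC exprVn ler_pdivlMr ?exprn_gt0// mulrC.
have -> : 2 ^+ k * D k w = ((2 ^+ k * D k w) `^ p) `^ p^-1.
  by rewrite -powRrM divff ?gt_eqF// powRr1// mulr_ge0// exprn_ge0.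
apply: ge0_ler_powR; rewrite ?nnegrE ?powR_ge0 ?fine_ge0 ?invr_ge0 ?(ltW p0)//.
rewrite -lee_fin fineK//.
apply: le_trans (nneseries_lim_ge k.+1 _); last by move=> *; exact: h0.
by rewrite big_nat_recr//= leeDr// sume_ge0.
Qed.

Lemma monotone_convex_continuous d (Omega : measurableType d) (R : realType)
    (p : R) (p1 : (1 <= p%:E)%E) (P : probability Omega R)
    (rho : LfunType P p1 -> R) (X : LfunType P p1) (e : R) :
  convex_function setT rho -> as_nondecreasing rho -> 0 < e ->
  exists2 dlt : R, 0 < dlt & forall Y : LfunType P p1,
    (\int[P]_w (`|Y w - X w| `^ p)%:E < dlt%:E)%E -> `|rho Y - rho X| < e.
Proof.
move=> rho_convex rho_nondecreasing e0.
have p0 : 0 < p by rewrite (lt_le_trans ltr01)// -lee_fin.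
(* The divisor absorbs the factor [2^k] inside the [p]-th power, leaving exactly the bound required
   by [Lp_dominating_sequence]. If no radius works, each [dlt k] has a counterexample [Y k], and
   then [e] is at most [2^-k] times a constant for every [k]. *)
pose dlt k : R := 2^-1 ^+ k.+1 / (2 ^+ k) `^ p.
have dlt0 k : 0 < dlt k by rewrite divr_gt0 ?powR_gt0 ?exprn_gt0.
apply: contrapT => /forall2NP H.
have /choice[Y HY] k : exists Y : LfunType P p1,
    (\int[P]_w (`|Y w - X w| `^ p)%:E < (dlt k)%:E)%E /\ e <= `|rho Y - rho X|.
  have [//|/existsNP[Y /not_implyP[? /negP]]] := H (dlt k).
  by rewrite -leNgt; exists Y.
have mD k : measurable_fun setT (fun w => `|Y k w - X w|).
  by apply: measurableT_comp => //; exact: measurable_funB.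
have mDp k : measurable_fun setT (fun w => (`|Y k w - X w| `^ p)%:E).
  by apply/measurable_EFinP; exact: (measurableT_comp (measurable_powR p)).
have intD k :
    (\int[P]_w ((2 ^+ k * `|Y k w - X w|) `^ p)%:E <= (2^-1 ^+ k.+1)%:E)%E.
  have [/ltW dk _] := HY k.
  under eq_integral do rewrite powRM// ?exprn_ge0// EFinM.
  rewrite ge0_integralZl//.
  apply: le_trans (lee_wpmul2l _ dk) _; first by rewrite lee_fin powR_ge0.
  by rewrite -EFinM lee_fin mulrC divfK// gt_eqF// powR_gt0 exprn_gt0.
have [//|Z [LZ aeZ]] := Lp_dominating_sequence p0 mD _ intD.
pose z := Lfun_Sub p1 LZ.
have rho_le k : e <= 2^-1 ^+ k * (rho (X + z) - rho X).
  have [_ ek] := HY k; apply: (le_trans ek).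
  apply: convex_increment_le => //.
    by rewrite exprn_ge0//= exprn_ile1//; lra.
  by apply: filterS aeZ => w /(_ k).
have : 2^-1 ^+ k * (rho (X + z) - rho X) @[k --> \oo] -->
    0 * (rho (X + z) - rho X).
  apply: cvgM; last exact: cvg_cst.
  by apply: cvg_expr; rewrite ger0_norm; lra.
rewrite mul0r => /cvgrPdist_lt /(_ e e0)[k _ /(_ k (leqnn k))].
by rewrite sub0r normrN ltNge (le_trans (rho_le k))// ler_norm.
Qed.

(** * Ramps and pointwise convergence of quantiles *)

Definition ramp (R : realType) (a b y : R) : R :=
  Num.max 0 (Num.min 1 ((b - y) / (b - a))).

Section ramp_theory.
Context (R : realType).
Implicit Types a b y : R.

Lemma ramp_ge0 a b y : 0 <= ramp a b y.
Proof. by rewrite /ramp le_max lexx. Qed.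

Lemma ramp_le1 a b y : ramp a b y <= 1.
Proof. by rewrite /ramp ge_max ler01 ge_min lexx. Qed.

Lemma ramp_eq1 a b y : a < b -> y <= a -> ramp a b y = 1.
Proof.
move=> ab ya; rewrite /ramp min_l ?max_r//.
by rewrite ler_pdivlMr; lra.
Qed.

Lemma ramp_eq0 a b y : a < b -> b <= y -> ramp a b y = 0.
Proof.
move=> ab ya; rewrite /ramp max_l// ge_min; apply/orP; right.
by rewrite ler_pdivrMr; lra.
Qed.

Lemma continuous_ramp a b : continuous (ramp a b).
Proof.
move=> y; apply: (@continuous_max _ _ (cst 0) (fun y => Num.min 1 _)).
  exact: cvg_cst.
apply: (@continuous_min _ _ (cst 1) (fun y => (b - y) / (b - a))).
  exact: cvg_cst.
by apply: cvgM; [apply: cvgB; [exact: cvg_cst|exact: cvg_id]|exact: cvg_cst].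
Qed.

Lemma measurable_ramp a b : measurable_fun [set: R] (ramp a b).
Proof. by apply: continuous_measurable_fun; exact: continuous_ramp. Qed.

Lemma integrable_ramp (mu : probability R R) a b :
  mu.-integrable setT (EFin \o ramp a b).
Proof.
apply: measurable_bounded_integrable => //.
- by rewrite ltey_eq fin_num_measure.
- exact: measurable_ramp.
- exists 1; split => // r r1 y _ /=.
  by rewrite ger0_norm ?ramp_ge0// (le_trans (ramp_le1 _ _ _))// ltW.
Qed.

Let integrable_cdf (mu : probability R R) a :
  mu.-integrable setT (EFin \o \1_(`]-oo, a]%classic : set R)).
Proof. by apply: integrable_indic => //; rewrite ltey_eq fin_num_measure. Qed.

Let Rintegral_cdf (mu : probability R R) a :
  (\int[mu]_y (\1_(`]-oo, a]%classic : set R) y))%R =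
  fine (mu `]-oo, a]%classic).
Proof. by rewrite /Rintegral integral_indic// setIT. Qed.

(** The ramp lies between the indicators of []-oo, a]] and []-oo, b]]. This bound and the next one
    transfer information between distribution functions and integrals of continuous functions. *)
Lemma cdf_le_integral_ramp (mu : probability R R) a b : a < b ->
  fine (mu `]-oo, a]%classic) <= (\int[mu]_y ramp a b y)%R.
Proof.
move=> ab; rewrite -Rintegral_cdf.
apply: le_Rintegral => //.
- exact: integrable_cdf.
- exact: integrable_ramp.
move=> y _; rewrite indicE; case: (boolP (y \in _)) => [|_]; last exact: ramp_ge0.
by rewrite inE/= in_itv/= => ya; rewrite ramp_eq1.
Qed.

Lemma integral_ramp_le_cdf (mu : probability R R) a b : a < b ->
  (\int[mu]_y ramp a b y)%R <= fine (mu `]-oo, b]%classic).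
Proof.
move=> ab; rewrite -Rintegral_cdf.
apply: le_Rintegral => //.
- exact: integrable_ramp.
- exact: integrable_cdf.
move=> y _; rewrite indicE; case: (boolP (y \in _)) => [_|]; first exact: ramp_le1.
rewrite notin_setE/= in_itv/= => /negP; rewrite -ltNge => /ltW by_.
by rewrite ramp_eq0.
Qed.

(** Ramps with rational endpoints just above and just below the limit quantile have [mu0]-integrals
    strictly above and strictly below [u]. The strict inequalities persist for large [k] and trap
    the quantile of [mu k]. Excluding the countably many levels [F(a)], [a] rational, makes the
    upper inequality strict. *)
Lemma cvg_quantile (mu : nat -> probability R R) (mu0 : probability R R) u :
  0 < u < 1 -> (forall a : rat, fine (mu0 `]-oo, (ratr a : R)]%classic) != u) ->
  (forall a b : rat, a < b ->
    (\int[mu k]_y ramp (ratr a : R) (ratr b) y)%R @[k --> \oo] -->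
    (\int[mu0]_y ramp (ratr a : R) (ratr b) y)%R) ->
  quantile (mu k) u @[k --> \oo] --> quantile mu0 u.
Proof.
move=> u01 nu cv; set q := quantile mu0 u.
have qE (m : probability R R) x :
    (quantile m u <= x) = (u <= fine (m `]-oo, x]%classic)).
  by rewrite quantile_le// -lee_fin fineK// fin_num_measure.
apply/cvgrPdist_le => e e0.
have qe : q < q + e by rewrite ltrDl.
have eq_ : q - e < q by rewrite gtrBl.
have [b1 /[!in_itv]/=/andP[qb1 b1e]] := rat_in_itvoo qe.
have [a1 /[!in_itv]/=/andP[qa1 a1b1]] := rat_in_itvoo qb1.
have [a2 /[!in_itv]/=/andP[ea2 a2q]] := rat_in_itvoo eq_.
have [b2 /[!in_itv]/=/andP[a2b2 b2q]] := rat_in_itvoo a2q.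
have up : u < (\int[mu0]_y ramp (ratr a1 : R) (ratr b1) y)%R.
  apply: lt_le_trans (cdf_le_integral_ramp _ _); last exact: a1b1.
  by rewrite lt_neqAle eq_sym nu -qE ltW.
have dn : (\int[mu0]_y ramp (ratr a2 : R) (ratr b2) y)%R < u.
  apply: le_lt_trans (integral_ramp_le_cdf _ _) _; first exact: a2b2.
  by rewrite ltNge -qE -ltNge.
have ab1 : a1 < b1 by rewrite -(ltr_rat R).
have ab2 : a2 < b2 by rewrite -(ltr_rat R).
near=> k; rewrite ler_norml; apply/andP; split.
- suff : quantile (mu k) u <= ratr b1 by lra.
  rewrite qE; apply: le_trans (integral_ramp_le_cdf _ a1b1); apply: ltW.
  by near: k; move/cvgr_gt : (cv _ _ ab1); exact.
- suff : ratr a2 < quantile (mu k) u by lra.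
  rewrite ltNge qE -ltNge; apply: le_lt_trans (cdf_le_integral_ramp _ a2b2) _.
  by near: k; move/cvgr_lt : (cv _ _ ab2); exact.
Unshelve. all: by end_near. Qed.

End ramp_theory.

(** * Convergence in [L^p] of the quantile transforms *)

Lemma continuous_normr_powR (R : realType) (p : R) : 0 < p ->
  continuous (fun x : R => `|x| `^ p).
Proof.
move=> p0 x; have [->|x0] := eqVneq x 0.
  rewrite /continuous_at normr0 powR0 ?gt_eqF//; apply/cvgrPdist_lt => e e0.
  near=> y; rewrite sub0r normrN ger0_norm ?powR_ge0//.
  rewrite -[e](@powRr1 R)// ?ltW// -(mulVf (lt0r_neq0 p0)) powRrM.
  apply: gt0_ltr_powR; rewrite ?nnegrE ?powR_ge0//.
  near: y; apply/nbhs_normP; exists (e `^ p^-1); first by rewrite /= powR_gt0.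
  by move=> y /=; rewrite sub0r normrN.
have nx0 : `|x| != 0 by rewrite normr_eq0.
have nx_gt0 : 0 < `|x| by rewrite normr_gt0.
rewrite /continuous_at /powR (negbTE nx0).
have : expR (p * ln `|y|) @[y --> x] --> expR (p * ln `|x|).
  apply: continuous_cvg; first exact: continuous_expR.
  apply: cvgM; first exact: cvg_cst.
  apply: (@continuous_cvg _ _ _ _ _ _ (@ln R)); first exact: continuous_ln.
  exact: norm_continuous.
move=> H; apply: cvg_trans H; apply: near_eq_cvg; near=> y.
rewrite gt_eqF//; near: y.
exact: (cvgr_gt _ (@norm_continuous _ _ x)).
Unshelve. all: by end_near. Qed.

Lemma powR_normB_le (R : realType) (p a b : R) : 0 < p ->
  `|a - b| `^ p <= 2 `^ p * (`|a| `^ p + `|b| `^ p).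
Proof.
move=> p0; wlog ab : a b / `|a| <= `|b| => [H|].
  have /orP[/H//|/H] := le_total `|a| `|b|.
  by rewrite distrC [X in _ * X]addrC.
apply: (@le_trans _ _ ((2 * `|b|) `^ p)).
  apply: ge0_ler_powR; rewrite ?nnegrE ?mulr_ge0 ?(ltW p0)//.
  by rewrite (le_trans (ler_normB _ _))// mulr2n mulrDl mul1r lerD2r.
by rewrite powRM// ler_wpM2l ?powR_ge0// lerDr powR_ge0.
Qed.

Section quantile_coupling.
Context d (Omega : measurableType d) (R : realType).
Context (P : probability Omega R) (U : {RV P >-> R}).
Hypothesis U01 : unif01 U.

Lemma unif01_ae (N : set R) : countable N ->
  {ae P, forall w, 0 < U w < 1 /\ ~ N (U w)}.
Proof.
move=> cN; pose B := `]-oo, 0] `|` `[1, +oo[ `|` N : set R.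
have mN : measurable N by exact: countable_measurable.
have mB : measurable B by do ?apply: measurableU.
have N0 : lebesgue_measure ([set 0] `|` [set 1] `|` N) = 0%E.
  rewrite measureU0//; last exact: countable_lebesgue_measure0.
    by rewrite measureU0//= lebesgue_measure_set1.
  exact: measurableU.
have B0 : distribution P U B = 0%E.
  rewrite U01// /uniform_prob integral_uniform_pdf.
  apply: null_set_integral.
  - exact: measurableI.
  - apply/measurable_EFinP; apply: measurable_funTS.
    exact: measurable_uniform_pdf.
  apply: (@subset_measure0 _ _ _ lebesgue_measure _ ([set 0] `|` [set 1] `|` N)).
  - exact: measurableI.
  - by do 2?apply: measurableU.
  - move=> u [+] /=; rewrite !in_itv/= => Bu /andP[u0 u1].
    move: Bu => [[|]|]; last by right.
    + by rewrite /= in_itv/= => u0'; left; left; apply/eqP; rewrite eq_le u0 u0'.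
    + rewrite /= in_itv/= andbT => u1'; left; right; apply/eqP.
      by rewrite eq_le u1 u1'.
  exact: N0.
exists (U @^-1` B); split => //.
- by rewrite -[X in measurable X]setTI; exact: measurable_funPT.
- move=> w /= /not_andP[/negP|/contrapT]; last by right.
  rewrite negb_and -!leNgt => /orP[?|?]; left; [left|right];
    by rewrite /= in_itv/= ?andbT.
Qed.

Lemma integral_quantile_tr (p : R) (mu : probability R R) :
  (\int[P]_w (`|quantile_tr U mu w| `^ p)%:E = \int[mu]_y (`|y| `^ p)%:E)%E.
Proof.
have mp : measurable_fun setT (fun y : R => (`|y| `^ p)%:E).
  apply/measurable_EFinP; apply: (measurableT_comp (measurable_powR p)).
  exact: normr_measurable.
rewrite [RHS](eq_measure_integral (distribution P (quantile_tr U mu))); last first.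
  by move=> A mA _; exact/esym/distribution_quantile_tr.
by rewrite ge0_integral_distribution// => y; rewrite lee_fin powR_ge0.
Qed.

Lemma integral_prob_moment (p : R) (mu : @M1R R p) :
  (\int[mu]_y (`|y| `^ p)%:E = (\int[mu]_y (`|y| `^ p))%R%:E)%E.
Proof.
rewrite /Rintegral fineK// ge0_fin_numE ?pm_moment//.
by apply: integral_ge0 => y _; rewrite lee_fin powR_ge0.
Qed.

(** A Fatou-type argument. With [c = 2^p], the bound on the distance gives [h k] an integral of at
    most [c (m k + m0) - e], which tends to [2 c m0 - e]. But [h k], truncated at its limit [G], has
    integrals tending to that of [G], which is [2 c m0]. *)
Lemma quantile_tr_Lp_dist_not_far (p e : R) (mu : nat -> M1R p) (mu0 : M1R p) :
  0 < p -> 0 < e ->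
  (forall a b : rat, a < b ->
    (\int[mu k]_y ramp (ratr a : R) (ratr b) y)%R @[k --> \oo] -->
    (\int[mu0]_y ramp (ratr a : R) (ratr b) y)%R) ->
  (\int[mu k]_y (`|y| `^ p))%R @[k --> \oo] --> (\int[mu0]_y (`|y| `^ p))%R ->
  ~ forall k, (e%:E <= \int[P]_w
    (`|quantile_tr U (mu k) w - quantile_tr U mu0 w| `^ p)%:E)%E.
Proof.
move=> p0 e0 cramp cmom far.
pose q k := quantile_tr U (mu k); pose q0 := quantile_tr U mu0.
pose c : R := 2 `^ p.
(* [h k] is nonnegative and tends to [G] almost surely; truncating it at [G]
   makes dominated convergence applicable. *)
pose h k w := c * (`|q k w| `^ p + `|q0 w| `^ p) - `|q k w - q0 w| `^ p.
have mq (nu : M1R p) : measurable_fun setT (quantile_tr U nu).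
  exact: measurable_quantile_tr.
have mpow (g : Omega -> R) : measurable_fun setT g ->
    measurable_fun setT (fun w => `|g w| `^ p).
  move=> mg; apply: (measurableT_comp (measurable_powR p)).
  exact: (measurableT_comp (@normr_measurable _ _)).
have mqk k : measurable_fun setT (fun w => `|q k w| `^ p) by exact: mpow.
have mq0 : measurable_fun setT (fun w => `|q0 w| `^ p) by exact: mpow.
have mqB k : measurable_fun setT (fun w => `|q k w - q0 w| `^ p).
  by apply: mpow; exact: measurable_funB.
have mh k : measurable_fun setT (h k).
  apply: measurable_funB => //; apply: measurable_funM => //.
  exact: measurable_funD.
have h0 k w : 0 <= h k w by rewrite subr_ge0 powR_normB_le.
pose G w := 2 * c * `|q0 w| `^ p.
have mG : measurable_fun setT G by exact: measurable_funM.
pose m k := (\int[mu k]_y (`|y| `^ p))%R; pose m0 := (\int[mu0]_y (`|y| `^ p))%R.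
have intq k : (\int[P]_w (`|q k w| `^ p)%:E = (m k)%:E)%E.
  by rewrite integral_quantile_tr integral_prob_moment.
have intq0 : (\int[P]_w (`|q0 w| `^ p)%:E = m0%:E)%E.
  by rewrite integral_quantile_tr integral_prob_moment.
have c0 : 0 <= c by exact: powR_ge0.
have intG : (\int[P]_w (G w)%:E = (2 * c * m0)%:E)%E.
  rewrite [RHS]EFinM -intq0 -ge0_integralZl//.
  - exact/measurable_EFinP.
  - by rewrite lee_fin mulr_ge0.
have iG : P.-integrable setT (EFin \o G).
  apply/integrableP; split; first exact/measurable_EFinP.
  under eq_integral do rewrite /= ger0_norm ?mulr_ge0 ?powR_ge0//.
  by rewrite intG ltry.
have inth k : (\int[P]_w (h k w)%:E <= (c * (m k + m0) - e)%:E)%E.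
  rewrite EFinB leeBrDr//; apply: le_trans (leeD2l _ (far k)) _.
  rewrite -ge0_integralD//; last 3 first.
  - by move=> w _; rewrite lee_fin.
  - exact/measurable_EFinP.
  - by apply/measurable_EFinP; exact: mqB.
  under eq_integral do rewrite -EFinD subrK EFinM EFinD.
  rewrite ge0_integralZl//; last 2 first.
  - by apply: emeasurable_funD; exact/measurable_EFinP.
  - by move=> w _; rewrite -EFinD lee_fin addr_ge0 ?powR_ge0.
  rewrite ge0_integralD//; [|exact/measurable_EFinP|exact/measurable_EFinP].
  by rewrite intq intq0 -EFinD -EFinM.
pose g k w := Num.min (h k w) (G w).
have cvg_ae : {ae P, forall w, setT w ->
    (g k w)%:E @[k --> \oo] --> (G w)%:E}.
  (* The levels to be excluded in [cvg_quantile]; being countable, they are almost surely avoided by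
     [U]. *)
  pose N := range (fun a : rat => fine (mu0 `]-oo, (ratr a : R)]%classic)).
  have cN : countable N.
    by apply: card_le_trans (card_image_le _ _) _; exact: countableP.
  apply: filterS (unif01_ae cN) => w [u01 NU] _.
  have qcvg : q k w @[k --> \oo] --> q0 w.
    apply: cvg_quantile => // a; apply/eqP => aU; apply: NU.
    by exists a.
  apply: cvg_EFin; first exact: nearW.
  have powc (v : R^nat) l : v @ \oo --> l ->
      `|v k| `^ p @[k --> \oo] --> `|l| `^ p.
    move=> vl.
    apply: (@continuous_cvg _ _ _ _ _ _ (fun x : R => `|x| `^ p)) => //.
    exact: (@continuous_normr_powR _ p p0).
  have hG : h k w @[k --> \oo] --> G w.
    have -> : G w = c * (`|q0 w| `^ p + `|q0 w| `^ p) - `|q0 w - q0 w| `^ p.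
      by rewrite subrr normr0 powR0 ?gt_eqF// subr0 /G; ring.
    apply: cvgB.
      apply: cvgM; first exact: cvg_cst.
      by apply: cvgD; [exact: powc|exact: cvg_cst].
    by apply: powc; apply: cvgB => //; exact: cvg_cst.
  have -> : G w = (G w + G w - `|G w - G w|) / 2 by rewrite subrr normr0; lra.
  rewrite [X in X @ _ --> _](_ : _ =
      fun k => (h k w + G w - `|h k w - G w|) / 2); last first.
    by apply/funext => k; rewrite /= /g minr_absE.
  apply: cvgM; last exact: cvg_cst.
  apply: cvgB; first by apply: cvgD => //; exact: cvg_cst.
  by apply: cvg_norm; apply: cvgB => //; exact: cvg_cst.
have gG k w : 0 <= g k w <= G w.
  by rewrite /g le_min h0 mulr_ge0 ?powR_ge0 ?ge_min ?lexx ?orbT//= mulr_ge0.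
have mg k : measurable_fun setT (g k) by exact: measurable_minr.
have gle w k : setT w -> (`|(g k w)%:E| <= (EFin \o G) w)%E.
  by have /andP[g0 gG'] := gG k w; rewrite /= lee_fin ger0_norm.
have [_ _ intcvg] := @dominated_convergence _ _ _ P setT measurableT
  (fun k w => (g k w)%:E) (EFin \o G) (EFin \o G)
  (fun k => (measurable_EFinP _ _).2 (mg k)) ((measurable_EFinP _ _).2 mG)
  cvg_ae iG (aeW _ gle).
have bcvg : (c * (m k + m0) - e)%:E @[k --> \oo] --> (2 * c * m0 - e)%:E.
  apply: cvg_EFin; first exact: nearW.
  have -> : 2 * c * m0 - e = c * (m0 + m0) - e by ring.
  apply: cvgB; last exact: cvg_cst.
  by apply: cvgM; [exact: cvg_cst|apply: cvgD; [exact: cmom|exact: cvg_cst]].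
have : ((2 * c * m0)%:E <= (2 * c * m0 - e)%:E)%E.
  rewrite -intG -(cvg_lim _ intcvg)// -(cvg_lim _ bcvg)//; apply: lee_lim.
  - by apply/cvg_ex; eexists; exact: intcvg.
  - by apply/cvg_ex; eexists; exact: bcvg.
  apply: nearW => k; apply: le_trans (inth k); apply: ge0_le_integral => //.
  - by move=> w _; rewrite lee_fin; case/andP: (gG k w).
  - exact/measurable_EFinP.
  - exact/measurable_EFinP.
  - by move=> w _; rewrite lee_fin ge_min lexx.
rewrite lee_fin; lra.
Qed.
End quantile_coupling.

(* The filter F need not be countably generated, but only countably many test
   functions matter, so the sequential statement suffices. *)
Lemma near_quantile_tr_Lp_dist_lt d (Omega : measurableType d) (R : realType)
    (P : probability Omega R) (U : {RV P >-> R}) (U01 : unif01 U)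
    (T : Type) (F : set_system T) (FF : Filter F) (p e : R)
    (mu : T -> @M1R R p) (mu0 : @M1R R p) :
  0 < p -> 0 < e ->
  (forall a b : R, a < b ->
    (\int[mu t]_y ramp a b y)%R @[t --> F] --> (\int[mu0]_y ramp a b y)%R) ->
  (\int[mu t]_y (`|y| `^ p))%R @[t --> F] --> (\int[mu0]_y (`|y| `^ p))%R ->
  \forall t \near F, (\int[P]_w
    (`|quantile_tr U (mu t) w - quantile_tr U mu0 w| `^ p)%:E < e%:E)%E.
Proof.
move=> p0 e0 cramp cmom.
(* [None] encodes the [p]-th power and pairs encode rational ramps. Unordered pairs give 0, so that
   convergence holds for every index of the enumeration. *)
pose test (i : option (rat * rat)) : R -> R := if i is Some (a, b) then
  if a < b then ramp (ratr a) (ratr b) else cst 0 else fun y => `|y| `^ p.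
pose g (j : nat) := test (odflt None (unpickle j)).
have cg j : (\int[mu t]_y g j y)%R @[t --> F] --> (\int[mu0]_y g j y)%R.
  rewrite /g; case: (odflt _ _) => [[a b]|//] /=; case: ifPn => [ab|_].
    by apply: cramp; rewrite ltr_rat.
  rewrite Rintegral_cst// mul0r; under eq_fun do rewrite Rintegral_cst// mul0r.
  exact: cvg_cst.
(* Only finitely many tests enter [V k], so it belongs to [F]. If the claim failed, each [V k] would
   contain a point at distance at least [e]; such points form a sequence along which all tests
   converge. *)
pose V k := [set t | forall j : 'I_k.+1,
  `|(\int[mu0]_y g j y)%R - (\int[mu t]_y g j y)%R| < k.+1%:R^-1].
have FV k : F (V k).
  apply: filter_forall => j; move/cvgrPdist_lt: (cg j); apply.
  by rewrite invr_gt0.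
apply: contrapT => nF.
have /choice[t tP] k : exists t, V k t /\ (e%:E <= \int[P]_w
    (`|quantile_tr U (mu t) w - quantile_tr U mu0 w| `^ p)%:E)%E.
  apply: contrapT => H; apply: nF; apply: filterS (FV k) => t Vt.
  by rewrite ltNge; apply/negP => le_e; apply: H; exists t.
have cvt i : (\int[mu (t k)]_y test i y)%R @[k --> \oo] -->
    (\int[mu0]_y test i y)%R.
  apply/cvgrPdist_lt => eps eps0.
  near=> k.
  have ik : (pickle i < k.+1)%N.
    by rewrite ltnS; near: k; exact: nbhs_infty_ge.
  have gi : g (pickle i) = test i by rewrite /g pickleK.
  have [/(_ (Ordinal ik)) tk _] := tP k.
  rewrite -[nat_of_ord _]/(pickle i) gi in tk.
  apply: (lt_trans tk); near: k; exact: near_infty_natSinv_lt (PosNum eps0).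
apply: (@quantile_tr_Lp_dist_not_far _ _ _ _ _ U01 p e (mu \o t) mu0 p0 e0).
- by move=> a b ab; have := cvt (Some (a, b)); rewrite /= ab.
- exact: (cvt None).
- by move=> k; have [] := tP k.
Unshelve. all: by end_near. Qed.

(** * Weak topology and Lipschitz envelopes *)

Lemma cvg_integral_M1 (R : realType) (n : nat) (q : R) (nu : M1 n q)
    (g : 'rV[R]_n -> R) (C : R) : continuous g ->
  (forall z, `|g z| <= C * (1 + enorm z `^ q)) ->
  (fun mu : M1 n q => \int[mu]_z g z)%R @ nbhs nu --> (\int[nu]_z g z)%R.
Proof.
move=> cg gC.
have Hub : has_ubound (range (fun y => `|g y| / (1 + enorm y `^ q))).
  exists C => _ [z _ <-]; rewrite ler_pdivrMr ?gC//.
  by rewrite ltr_pwDl ?powR_ge0.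
pose t : test_fun n q := exist _ g (conj cg Hub).
pose I (g : test_fun n q) (mu : M1 n q) : R := (\int[mu]_z (projT1 g z))%R.
pose Tc (g : test_fun n q) := Topological.class (initial_topology (I g)).
(* Convergence in a supremum topology is convergence in each member; here the member is the initial
   topology of integration against [g]. *)
have /(_ _ t) H := (@cvg_sup _ _ Tc (nbhs (nu : M1 n q)) nu _).1
  (@cvg_id _ (nbhs (nu : M1 n q))).
apply: cvg_trans (@initial_continuous (M1 n q) R (I t) nu).
exact: cvg_app H.
Qed.

Definition l1dist (R : realType) (s : nat) (z z' : 'rV[R]_s) : R :=
  \sum_i `|z 0 i - z' 0 i|.

Section l1dist_theory.
Context (R : realType) (s : nat).
Implicit Types z : 'rV[R]_s.

Lemma l1dist_ge0 z1 z2 : 0 <= l1dist z1 z2.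
Proof. exact: sumr_ge0. Qed.

Lemma l1dist0 z : l1dist z z = 0.
Proof. by rewrite /l1dist big1// => i _; rewrite subrr normr0. Qed.

Lemma l1distC z1 z2 : l1dist z1 z2 = l1dist z2 z1.
Proof. by apply: eq_bigr => i _; rewrite distrC. Qed.

Lemma l1dist_triangle z1 z2 z3 : l1dist z1 z3 <= l1dist z1 z2 + l1dist z2 z3.
Proof.
rewrite /l1dist -big_split/=; apply: ler_sum => i _.
by rewrite (_ : _ - _ = (z1 0 i - z2 0 i) + (z2 0 i - z3 0 i)) ?ler_normD//; ring.
Qed.

Lemma l1dist_ball z1 z2 e : l1dist z1 z2 < e -> ball z1 e z2.
Proof.
move=> ze; split; first exact: le_lt_trans (l1dist_ge0 _ _) ze.
move=> i j; rewrite ord1; apply: le_lt_trans ze.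
by rewrite /l1dist (bigD1 j)//= lerDl sumr_ge0.
Qed.

Lemma near_l1dist z e : 0 < e -> \forall z' \near z, l1dist z z' < e.
Proof.
(* With [s.+1] in place of [s], the sum of [s] copies of [d] stays strictly below [e], also for
   [s = 0]. *)
move=> e0; pose d := e / s.+1%:R.
have d0 : 0 < d by rewrite divr_gt0.
apply: filterS (nbhsx_ballx z d d0) => z' [_ zz'].
apply: (@le_lt_trans _ _ (\sum_(i < s) d)).
  by apply: ler_sum => i _; apply: ltW; exact: zz'.
rewrite sumr_const card_ord -mulr_natl /d mulrCA gtr_pMr//.
by rewrite ltr_pdivrMr// mul1r ltr_nat.
Qed.

End l1dist_theory.

Section lipschitz_envelope.
Context (R : realType) (n s : nat) (psi : 'rV[R]_n * 'rV[R]_s -> R).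
Context (x : 'rV[R]_n) (r C : R).
Hypothesis r0 : 0 < r.
Hypothesis psiC : forall x' z, ball x r x' -> `|psi (x', z)| <= C.

(* The infimal convolution of [- psi] with the distance, made uniform in the
   first variable near [x]: Lipschitz, and decreasing with [k] to the upper
   semicontinuous envelope of [psi] along [x]. *)
Definition envelope (k : nat) (z : 'rV[R]_s) : R :=
  sup [set psi (y.1, y.2) - k%:R * l1dist z y.2 |
    y in [set y | ball x (r / k.+1%:R) y.1]].

Let sub_ball k x' : ball x (r / k.+1%:R) x' -> ball x r x'.
Proof.
by apply: le_ball; rewrite ler_pdivrMr// ler_peMr ?ler1n// ltW.
Qed.

Let center k : ball x (r / k.+1%:R) x.
Proof. by apply: ballxx; rewrite divr_gt0. Qed.

Let le_C k z z' x' : ball x (r / k.+1%:R) x' ->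
  psi (x', z') - k%:R * l1dist z z' <= C.
Proof.
move=> /sub_ball/psiC => /(_ z'); rewrite ler_norml => /andP[_].
by apply: le_trans; rewrite gerBl mulr_ge0// l1dist_ge0.
Qed.

Let has_sup_envelope k z : has_sup [set psi (y.1, y.2) - k%:R * l1dist z y.2 |
    y in [set y | ball x (r / k.+1%:R) y.1]].
Proof.
split; first by exists (psi (x, z) - k%:R * l1dist z z), (x, z) => //=.
by exists C => _ [[x' z'] /= xx' <-]; exact: le_C.
Qed.

Lemma le_envelope k x' z : ball x (r / k.+1%:R) x' ->
  psi (x', z) <= envelope k z.
Proof.
move=> xx'; apply: ub_le_sup; first exact: (has_sup_envelope _ _).2.
by exists (x', z) => //=; rewrite l1dist0 mulr0 subr0.
Qed.

Lemma envelope_le k z M :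
  (forall x' z', ball x (r / k.+1%:R) x' ->
     psi (x', z') - k%:R * l1dist z z' <= M) -> envelope k z <= M.
Proof.
move=> H; apply: ge_sup; first exact: (has_sup_envelope _ _).1.
by move=> _ [[x' z'] /= xx' <-]; exact: H.
Qed.

Lemma normr_envelope_le k z : `|envelope k z| <= C.
Proof.
rewrite ler_norml; apply/andP; split.
  apply: le_trans (le_envelope z (center k)).
  by have := psiC z (ballxx x r0); rewrite ler_norml => /andP[].
by apply: envelope_le => x' z'; exact: le_C.
Qed.

Lemma envelope_lipschitz k z1 z2 :
  envelope k z1 <= envelope k z2 + k%:R * l1dist z2 z1.
Proof.
apply: envelope_le => x' z' xx'.
have : psi (x', z') - k%:R * l1dist z2 z' <= envelope k z2.
  apply: ub_le_sup; first exact: (has_sup_envelope _ _).2.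
  by exists (x', z').
have := l1dist_triangle z2 z1 z'.
have := ler0n R k; nra.
Qed.

Lemma continuous_envelope k : continuous (envelope k).
Proof.
move=> z; apply/(@cvgrPdist_lt _ _ _ (nbhs z)) => e e0.
have e'0 : 0 < e / k.+1%:R by rewrite divr_gt0.
near=> z'; have : l1dist z z' < e / k.+1%:R by near: z'; exact: near_l1dist.
rewrite ltr_pdivlMr// => zz'.
apply: (@le_lt_trans _ _ (k%:R * l1dist z z')); last first.
  by apply: le_lt_trans zz'; rewrite mulrC ler_wpM2l ?l1dist_ge0// ler_nat.
have := envelope_lipschitz k z z'; have := envelope_lipschitz k z' z.
rewrite (l1distC z' z) => h1 h2.
rewrite ler_norml; apply/andP; split; lra.
Unshelve. all: by end_near. Qed.

(** The value at [(x, z)] is always a lower bound. For the upper bound, points [z'] near [z] are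
    handled by continuity, since the ball around [x] shrinks. At [z'] farther than [dl], the penalty
    is at least [k * dl], which eventually exceeds the largest possible variation [2 * C] of
    [psi]. *)
Lemma cvg_envelope z : {for (x, z), continuous psi} ->
  envelope k z @[k --> \oo] --> psi (x, z).
Proof.
move=> cpsi; apply/cvgrPdist_le => e e0.
have /nbhs_ballP[dl /= dl0 Hdl] : nbhs (x, z) [set y | `|psi (x, z) - psi y| < e].
  by move/cvgrPdist_lt: cpsi; exact.
near=> k.
have lo : psi (x, z) <= envelope k z by exact: le_envelope (center k).
suff : envelope k z <= psi (x, z) + e.
  by move=> up; rewrite ler_norml; apply/andP; split; lra.
have kr : r / k.+1%:R <= dl.
  rewrite mulrC -ler_pdivlMr//; apply: ltW; near: k.
  exact: (near_infty_natSinv_lt (PosNum (divr_gt0 dl0 r0))).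
have kC : 2 * C <= k%:R * dl.
  by rewrite -ler_pdivrMr//; near: k; exact: nbhs_infty_ger.
apply: envelope_le => x' z' xx'.
have [zz'|zz'] := ltP (l1dist z z') dl.
  have : `|psi (x, z) - psi (x', z')| < e.
    by apply: Hdl; split => /=; [exact: le_ball kr _ xx'|exact: l1dist_ball].
  rewrite ltr_norml => /andP[h1 _].
  have := mulr_ge0 (ler0n R k) (l1dist_ge0 z z'); lra.
have := psiC z' (sub_ball xx'); have := psiC z (ballxx x r0).
rewrite !ler_norml => /andP[h1 _] /andP[_ h2].
have := ler_wpM2l (ler0n R k) zz'; lra.
Unshelve. all: by end_near. Qed.
End lipschitz_envelope.

(** * Upper semicontinuity of integrals with weighted growth *)

Section weight.
Context (R : realType) (s : nat) (q : R).
Implicit Types z : 'rV[R]_s.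

Lemma continuous_weight : 0 < q -> continuous (fun z => 1 + enorm z `^ q).
Proof.
move=> q0 z; apply: (@cvgD _ _ _ (nbhs z)); first exact: cvg_cst.
suff : {for z, continuous ((fun y : R => `|y| `^ q) \o @enorm R s)}.
  rewrite (_ : _ \o _ = fun z => enorm z `^ q)//.
  by apply/funext => y /=; rewrite ger0_norm// sqrtr_ge0.
apply: continuous_comp; first exact: continuous_enorm.
exact: continuous_normr_powR.
Qed.

Lemma weight_gt0 z : 0 < 1 + enorm z `^ q.
Proof. by rewrite ltr_pwDl ?powR_ge0. Qed.

Lemma integrable_weight_le (mu : M1 s q) (h : 'rV[R]_s -> R) (C : R) :
  measurable_fun setT h -> (forall z, `|h z| <= C * (1 + enorm z `^ q)) ->
  mu.-integrable setT (EFin \o h).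
Proof.
move=> mh hC.
have me : measurable_fun setT (fun z : 'rV[R]_s => enorm z `^ q).
  apply: (measurableT_comp (measurable_powR q)).
  exact: measurable_continuous_mx (@continuous_enorm R s).
have ie : mu.-integrable setT (EFin \o (fun z => enorm z `^ q)).
  apply/integrableP; split; first exact/measurable_EFinP.
  under eq_integral do rewrite /= ger0_norm ?powR_ge0//.
  exact: pm_moment.
have iw : mu.-integrable setT (EFin \o (fun z => C * (1 + enorm z `^ q))).
  rewrite (_ : _ \o _ = fun z => C%:E * (1%:E + (enorm z `^ q)%:E))%E.
    apply: integrableZl => //; apply: integrableD => //.
    exact: finite_measure_integrable_cst.
  by apply/funext => z /=; rewrite EFinM EFinD.
apply: le_integrable iw => //; first exact/measurable_EFinP.
by move=> z _ /=; rewrite lee_fin (le_trans (hC z))// ler_norm.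
Qed.

End weight.

(** The index [k] is fixed first, by dominated convergence under [nu] alone, so that the envelope
    integral exceeds the limit by less than [e / 2]. Only then does the measure move: [E k] is an
    admissible test function, and it dominates [phi (x', _)] for all [x'] in a ball depending on
    [k]. *)
Lemma integral_usc (R : realType) (n s : nat) (q : R)
    (phi : 'rV[R]_n * 'rV[R]_s -> R) (x : 'rV[R]_n) (nu : M1 s q) (r C e : R) :
  0 < q -> 0 < r -> 0 < e ->
  (forall x', measurable_fun setT (fun z => phi (x', z))) ->
  (forall x' z, ball x r x' -> `|phi (x', z)| <= C * (1 + enorm z `^ q)) ->
  {ae nu, forall z, {for (x, z), continuous phi}} ->
  \forall w \near (x, nu),
    (\int[(w.2 : M1 s q)]_z phi (w.1, z))%R < (\int[nu]_z phi (x, z))%R + e.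
Proof.
move=> q0 r0 e0 mphi phiC cphi.
pose W (z : 'rV[R]_s) := 1 + enorm z `^ q.
have W0 z : 0 < W z by exact: weight_gt0.
have cW : continuous W by exact: continuous_weight.
pose psi (y : 'rV[R]_n * 'rV[R]_s) := phi y / W y.2.
have psiC x' z : ball x r x' -> `|psi (x', z)| <= C.
  move=> xx'; rewrite /psi /= normrM normfV (gtr0_norm (W0 z)).
  by rewrite ler_pdivrMr// phiC.
pose E k z := envelope psi x r k z * W z.
have cE k : continuous (E k).
  move=> z; apply: (@cvgM _ _ (nbhs z)); last exact: cW.
  exact: (continuous_envelope r0 psiC).
have EC k z : `|E k z| <= C * W z.
  rewrite normrM (ger0_norm (ltW (W0 z))) ler_pM2r//.
  exact: (normr_envelope_le r0 psiC).
have mE k : measurable_fun setT (E k) by exact: measurable_continuous_mx.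
have iE (mu : M1 s q) k : mu.-integrable setT (EFin \o E k).
  exact: integrable_weight_le (EC k).
have iphi (mu : M1 s q) x' : ball x r x' ->
    mu.-integrable setT (EFin \o (fun z => phi (x', z))).
  by move=> xx'; apply: (@integrable_weight_le _ _ _ _ _ C) => // z; exact: phiC.
have iW : nu.-integrable setT (EFin \o (fun z => C * W z)).
  apply: (@integrable_weight_le _ _ _ _ _ `|C|).
    by apply: measurable_funM => //; exact: measurable_continuous_mx.
  by move=> z; rewrite normrM (ger0_norm (ltW (W0 z))).
have aeE : {ae nu, forall z, setT z ->
    (E k z)%:E @[k --> \oo] --> (phi (x, z))%:E}.
  apply: filterS cphi => z cz _; apply: cvg_EFin; first exact: nearW.
  have -> : phi (x, z) = psi (x, z) * W z by rewrite /psi divfK// gt_eqF.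
  apply: cvgM; last exact: cvg_cst.
  apply: (cvg_envelope r0 psiC).
  apply: cvgM => //.
  apply: cvgV; first by rewrite gt_eqF.
  apply: (@continuous_comp _ _ _ snd W); first exact: cvg_snd.
  exact: cW.
have [_ _] := @dominated_convergence _ _ _ nu setT measurableT
  (fun k z => (E k z)%:E) (fun z => (phi (x, z))%:E) (EFin \o (fun z => C * W z))
  (fun k => (measurable_EFinP _ _).2 (mE k)) ((measurable_EFinP _ _).2 (mphi x))
  aeE iW (aeW _ (fun z k _ => EC k z)).
have <- : ((\int[nu]_z phi (x, z))%R%:E = \int[nu]_z (phi (x, z))%:E)%E.
  rewrite /Rintegral fineK//; apply: integrable_fin_num => //.
  exact/iphi/ballxx.
move=> /fine_cvg Ecvg.
have e20 : 0 < e / 2 by rewrite divr_gt0.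
have /cvgr_lt/(_ ((\int[nu]_z phi (x, z))%R + e / 2)) := Ecvg.
rewrite ltrDl => /(_ e20)[k _ /(_ k (leqnn k)) /= Ek].
have nx : \forall w \near (x, nu), ball x (r / k.+1%:R) w.1.
  by apply: cvg_fst; apply: nbhsx_ballx; rewrite divr_gt0.
have nnu : \forall w \near (x, nu), (\int[(w.2 : M1 s q)]_z E k z)%R <
    (\int[nu]_z phi (x, z))%R + e.
  have EkC : (\int[nu]_z E k z)%R < (\int[nu]_z phi (x, z))%R + e.
    by apply: (lt_trans Ek); rewrite ltrD2l gtr_pMr//; lra.
  have /cvgr_lt/(_ _ EkC) H := cvg_integral_M1 (nu := nu) (cE k) (EC k).
  exact: (@cvg_snd _ _ (nbhs x) (nbhs nu) _ _ H).
near=> w.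
have xw : ball x (r / k.+1%:R) w.1 by near: w.
apply: (@le_lt_trans _ _ (\int[(w.2 : M1 s q)]_z E k z)%R); last by near: w.
apply: le_Rintegral => //.
- apply: iphi; apply: le_ball xw.
  by rewrite ler_pdivrMr// ler_peMr ?ler1n// ltW.
- exact: iE.
move=> z _; rewrite /E -ler_pdivrMr//.
exact: (le_envelope r0 psiC (x' := w.1)).
Unshelve. all: by end_near. Qed.

(** * The discontinuity set along the fibre over [x] *)

Lemma measurable_continuity_section (R : realType) (n s : nat)
    (f : 'rV[R]_n * 'rV[R]_s -> R) (x : 'rV[R]_n) :
  measurable [set z | ~ {for (x, z), continuous f}].
Proof.
(* Points where the oscillation of [f] is controlled by [1 / (k + 1)]. These sets are open for
   arbitrary [f], and continuity at [(x, z)] means that [z] lies in all of them. *)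
pose O k := [set z | exists2 r, 0 < r & forall y1 y2, ball (x, z) r y1 ->
  ball (x, z) r y2 -> `|f y1 - f y2| < k.+1%:R^-1].
have oO k : open (O k).
  rewrite openE => z [r r0 Hr]; apply/nbhs_ballP.
  have r20 : 0 < r / 2 by rewrite divr_gt0.
  exists (r / 2) => // z' zz'; exists (r / 2) => // y1 y2.
  have sub y : ball (x, z') (r / 2) y -> ball (x, z) r y.
    by apply: ball_split; split => //=; exact: ballxx.
  by move=> /sub h1 /sub h2; exact: Hr.
rewrite (_ : [set z | _] = \bigcup_k ~` O k).
  apply: bigcup_measurable => k _; apply: measurableC.
  by apply: sub_sigma_algebra; exact: oO.
apply/seteqP; split => z /=.
  apply: contra_notP => H.
  have Oz k : O k z by apply: contrapT => nO; apply: H; exists k.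
  apply/cvgrPdist_lt => e e0.
  have [k _ /(_ k (leqnn k)) ke] := near_infty_natSinv_lt (PosNum e0).
  have [r r0 Hr] := Oz k.
  have nb : nbhs (x, z) (ball (x, z) r) by exact: nbhsx_ballx.
  near=> y; have xy : ball (x, z) r y by near: y; exact: nb.
  by apply: lt_trans ke; apply: Hr => //; exact: ballxx.
move=> [k _ nO] /cvgrPdist_lt; apply: contra_not nO => cf.
have e0 : 0 < k.+1%:R^-1 / 2 :> R by rewrite divr_gt0 ?invr_gt0.
have /nbhs_ballP[r /= r0 Hr] :
  nbhs (x, z) [set y | `|f (x, z) - f y| < k.+1%:R^-1 / 2] by exact: cf.
exists r => // y1 y2 /Hr h1 /Hr h2.
rewrite [ltRHS]splitr (_ : f y1 - f y2 = (f (x, z) - f y2) - (f (x, z) - f y1)).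
  by rewrite (le_lt_trans (ler_normB _ _))// ltrD.
by ring.
Unshelve. all: by end_near. Qed.

Lemma measurable_set1_rV (R : realType) (n : nat) (x : 'rV[R]_n) :
  measurable [set x].
Proof.
rewrite (_ : [set x] = \bigcap_(i in [set: 'I_n]) [set y | y 0 i = x 0 i]).
  apply: fin_bigcap_measurable => // i _.
  have mi : measurable_fun setT (fun y : 'rV[R]_n => y 0 i).
    by apply: measurable_continuous_mx; exact: coord_continuous.
  by have := mi measurableT _ (measurable_set1 (x 0 i)); rewrite setTI.
apply/seteqP; split => [y ->//|y xy].
by apply/rowP => i; exact: xy.
Qed.

(* Nothing is known about the measurability of [A]; the integral of an arbitrary
   nonnegative function against a Dirac mass at a measurable point still
   dominates the value at the point. *)
Section dirac_product.
Import HBNNSimple.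

Lemma dirac_product_null (R : realType) (d1 d2 : measure_display)
    (T1 : measurableType d1) (T2 : measurableType d2) (x : T1)
    (nu : probability T2 R) (A : set (T1 * T2)) : measurable [set x] ->
  (\d_x \x nu)%E A = 0%E -> nu (xsection A x) = 0%E.
Proof.
move=> mx; rewrite /product_measure1 => A0.
have F0 y : (0 <= (nu \o xsection A) y)%E by exact: measure_ge0.
apply/eqP; rewrite eq_le measure_ge0 andbT leNgt; apply/negP => nu0.
have : exists2 c : R, 0 < c & (c%:E <= nu (xsection A x))%E.
  case: (nu (xsection A x)) nu0 => [c||//]; first by rewrite lte_fin; exists c.
  by exists 1 => //; exact: leey.
move=> [c c0 cA].
(* A simple function below the section measure with Dirac integral [c], hence a competitor in the
   supremum defining the integral. *)
pose h := scale_nnsfun (indic_nnsfun R mx) (ltW c0).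
have hE y : h y = c * \1_[set x] y by [].
suff : (c%:E <= \int[\d_x]_y (nu \o xsection A) y)%E.
  by rewrite A0 lee_fin leNgt c0.
rewrite ge0_integralTE//.
have -> : c%:E = sintegral \d_x h.
  have := integral_nnsfun \d_x measurableT h; rewrite patch_setT => <-.
  rewrite integral_dirac//; last exact/measurable_EFinP/measurable_funPT.
  by rewrite diracT mul1e hE indicE mem_set// mulr1.
apply: ereal_sup_ubound; exists h => // y.
rewrite hE indicE; case: (boolP (y \in [set x])) => [|_]; last by rewrite mulr0.
by rewrite inE /= => ->; rewrite mulr1.
Qed.

End dirac_product.

(** * Integrals against the image measures, and continuity of [risk_Q] *)

Lemma Rintegral_image_M1 (R : realType) (n s : nat) (p gamma : R)
    (f : 'rV[R]_n * 'rV[R]_s -> R) (mf : measurable_fun setT f)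
    (p1 : (1 <= p%:E)%E) (fgamma : limited_by f gamma)
    (x : 'rV[R]_n) (nu : M1 s (gamma * p)) (g : R -> R) :
  measurable_fun setT g -> (forall y, 0 <= g y) ->
  (\int[image_M1 mf p1 fgamma x nu]_y g y)%R = (\int[nu]_z g (f (x, z)))%R.
Proof.
move=> mg g0; congr fine.
have mgE : measurable_fun setT (fun y : R => (g y)%:E) by exact/measurable_EFinP.
rewrite -[LHS]/(\int[image_prob mf x nu]_y (g y)%:E)%E /image_prob.
rewrite ge0_integral_distribution//.
have mgf : measurable_fun setT ((fun y => (g y)%:E) \o mimage_fun f).
  by apply: (measurableT_comp mgE); exact: mf.
rewrite (fubini_tonelli1 _ mgf); last by move=> w; rewrite lee_fin.
rewrite integral_dirac//; last first.
  by apply: measurable_fun_fubini_tonelli_F => // w; rewrite lee_fin.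
by rewrite diracT mul1e.
Qed.

Lemma cvg_Rintegral_image (R : realType) (n s : nat) (p gamma : R)
    (f : 'rV[R]_n * 'rV[R]_s -> R) (mf : measurable_fun setT f)
    (p1 : (1 <= p%:E)%E) (gamma_gt0 : 0 < gamma) (fgamma : limited_by f gamma)
    (x : 'rV[R]_n) (nu : M1 s (gamma * p)) (g : R -> R) (K : R) :
  (\d_x \x nu)%E (discontinuity_set f) = 0%E ->
  continuous g -> (forall y, 0 <= g y) ->
  0 <= K -> (forall y, g y <= K * (1 + `|y| `^ p)) ->
  (fun w : 'rV[R]_n * M1 s (gamma * p) =>
    (\int[image_M1 mf p1 fgamma w.1 w.2]_y g y)%R) @ (x, nu) -->
  (\int[image_M1 mf p1 fgamma x nu]_y g y)%R.
Proof.
move=> Df0 cg g0 K0 gK.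
have p0 : 0 < p by rewrite (lt_le_trans ltr01)// -lee_fin.
have mg : measurable_fun setT g by apply: continuous_measurable_fun.
under eq_fun do rewrite Rintegral_image_M1//.
rewrite Rintegral_image_M1//.
have [eta [eta0 eta_loc fle]] := fgamma.
have [M M0 /nbhs_ballP[r /= r0 etaM]] : exists2 M, 0 < M &
    nbhs x [set x' | `|eta x'| <= M].
  have [M [_ HM]] := eta_loc x.
  exists (`|M| + 1); first by rewrite ltr_wpDl.
  by apply: HM; rewrite (le_lt_trans (ler_norm _))// ltrDl.
pose q := gamma * p; have q0 : 0 < q by exact: mulr_gt0.
(* Obtained from [g y <= K * (1 + |y|^p)] and the bound of [|f|^p] by [(2 * M)^p] times the weight,
   valid for [x'] in the ball where [eta] is at most [M]. *)
pose C := K * (1 + (2 * M) `^ p).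
have gfC x' z : ball x r x' -> `|g (f (x', z))| <= C * (1 + enorm z `^ q).
  move=> xx'; rewrite ger0_norm// (le_trans (gK _))// -mulrA ler_wpM2l//.
  have : `|f (x', z)| `^ p <= (2 * M) `^ p * (1 + enorm z `^ q).
    rewrite powRM ?(ltW M0)// /q powRrM; set a := enorm z `^ gamma.
    have a0 : 0 <= a by exact: powR_ge0.
    apply: (@le_trans _ _ ((M * (a + 1)) `^ p)).
      apply: ge0_ler_powR; rewrite ?nnegrE ?mulr_ge0 ?addr_ge0 ?(ltW p0) ?(ltW M0)//.
      apply: (le_trans (fle _ _)); rewrite ler_wpM2r ?addr_ge0//.
      by apply: le_trans (etaM _ xx'); exact: ler_norm.
    rewrite powRM ?addr_ge0 ?(ltW M0)// [2 `^ p * _]mulrC -mulrA ler_wpM2l ?powR_ge0//.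
    (* The choice of [-1] turns the difference into [a + 1]. *)
    have := powR_normB_le a (-1) p0.
    rewrite opprK normrN1 powR1 (ger0_norm a0) ger0_norm ?addr_ge0//.
    by rewrite [a `^ p + 1]addrC.
  have := powR_ge0 (enorm z) q; have := powR_ge0 (2 * M) p; nra.
have mgf x' : measurable_fun setT (fun z => g (f (x', z))).
  apply: (measurableT_comp mg); apply: (measurableT_comp mf).
  exact: pair1_measurable.
have cgf : {ae nu, forall z, {for (x, z), continuous (g \o f)}}.
  exists [set z | ~ {for (x, z), continuous f}]; split.
  - exact: measurable_continuity_section.
  - apply: etrans (dirac_product_null (measurable_set1_rV x) Df0).
    congr (nu _); apply/seteqP; split => z; first by move=> ?; exact/xsectionP.
    by move=> /xsectionP.
  - move=> z /=; apply: contra_not => cf.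
    by apply: continuous_comp => //; exact: cg.
have iphi (w : 'rV[R]_n * M1 s q) : ball x r w.1 ->
    w.2.-integrable setT (EFin \o (fun z => g (f (w.1, z)))).
  move=> xw; apply: (@integrable_weight_le _ _ q w.2 _ C) => // z.
  exact: gfC.
apply/cvgrPdist_lt => e e0.
have up := integral_usc q0 r0 e0 mgf gfC cgf.
(* Upper semicontinuity for the negative gives the lower bound; the scalar form [-1 * _] lets
   [RintegralZl] pull out the sign. *)
have lo := @integral_usc _ _ _ _ (fun y => -1 * g (f y)) x nu r C e q0 r0 e0.
near=> w.
have xw : ball x r w.1.
  near: w; apply: cvg_fst; exact: nbhsx_ballx.
have h1 : (\int[(w.2 : M1 s q)]_z g (f (w.1, z)))%R <
    (\int[nu]_z g (f (x, z)))%R + e by near: w; exact: up.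
have h2 : (\int[(w.2 : M1 s q)]_z (-1 * g (f (w.1, z))))%R <
    (\int[nu]_z (-1 * g (f (x, z))))%R + e.
  near: w; apply: lo.
  - by move=> x'; exact: measurable_funM.
  - by move=> x' z xx'; rewrite mulN1r normrN; exact: gfC.
  - apply: filterS cgf => z cz; apply: cvgM => //; exact: cvg_cst.
rewrite (RintegralZl _ _ (iphi w xw))// in h2.
rewrite (RintegralZl _ _ (iphi (x, nu) (ballxx x r0)))// in h2.
rewrite ltr_norml; apply/andP; split; lra.
Unshelve. all: by end_near. Qed.

Theorem theorem3 (R : realType) (p : R) (p1 : (1 <= p%:E)%E)
    (d : measure_display) (Omega : measurableType d) (P : probability Omega R)
    (U : {RV P >-> R}) (U01 : unif01 U)
    (rho : LfunType P p1 -> R)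
    (rho_convex : convex_function setT rho)
    (rho_nondecreasing : as_nondecreasing rho)
    (rho_law_invariant : law_invariant rho)
    (n s : nat) (f : 'rV[R]_n * 'rV[R]_s -> R)
    (mf : measurable_fun setT f)
    (gamma : R) (gamma_gt0 : 0 < gamma) (fgamma : limited_by f gamma)
    (x : 'rV[R]_n) (nu : M1 s (gamma * p))
    (Df0 : (\d_x \x nu)%E (discontinuity_set f) = 0%E) :
  {for (x, nu), continuous (risk_Q rho U01 mf fgamma)}.
Proof.
have p0 : 0 < p by rewrite (lt_le_trans ltr01)// -lee_fin.
(* The growth constant 1 serves both kinds of test function: ramps, bounded by 1, and the [p]-th
   power of the absolute value. *)
have cvg_int (g : R -> R) := @cvg_Rintegral_image R n s p gamma f mf p1 gamma_gt0
  fgamma x nu g 1 Df0.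
apply/(@cvgrPdist_lt _ _ _ (nbhs (x, nu))) => e e0.
have [dl dl0 Hdl] := @monotone_convex_continuous _ _ _ _ _ P rho
  (quantile_Lp p1 U01 (image_M1 mf p1 fgamma x nu)) e
  rho_convex rho_nondecreasing e0.
near=> w; rewrite distrC; apply: Hdl; near: w.
apply: (@near_quantile_tr_Lp_dist_lt _ _ _ P U U01 _ (nbhs (x, nu)) _ p dl
  (fun w : 'rV[R]_n * M1 s (gamma * p) => image_M1 mf p1 fgamma w.1 w.2)
  (image_M1 mf p1 fgamma x nu) p0 dl0) => [a b ab|].
- apply: cvg_int => //; [exact: continuous_ramp|exact: ramp_ge0|].
  by move=> y; rewrite mul1r (le_trans (ramp_le1 _ _ _))// lerDl powR_ge0.
- apply: cvg_int => //; first exact: continuous_normr_powR.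
  by move=> y; rewrite mul1r lerDr.
Unshelve. all: by end_near. Qed.
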